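(* For every $\epsilon \in (0,0.1)$, there exists a positive integer $n$ such that any randomized one-pass streaming algorithm that outputs an $(\epsilon,\rho)$-additive solution to the Klee's measure problem for all streams of at most $2n$ intervals in $\mathbb{R}$ uses $\Omega\left(\frac{1}{\epsilon} + \log n\right)$ bits of space.
   Context: Klee's measure problem: given a stream of axis-parallel hyperrectangles $R_1, R_2, \ldots$ in $\mathbb{R}^d$, report the volume $V$ of $\bigcup_i R_i$; for $d=1$ the hyperrectangles are intervals and $V$ is the total length of their union. A one-pass (insertion-only) streaming algorithm reads the stream items once in order and keeps only a memory state; its space is the maximum number of bits of that state. Randomized algorithms use private random bits (random bits that are to be remembered are part of the memory state). An $(\epsilon,\rho)$-additive solution is an output $V'$ which satisfies $|V'-V| \le \epsilon$ with probability at least $1-\rho$; here $\rho=\frac13$. The constant hidden in $\Omega(\cdot)$ is absolute (independent of $\epsilon$ and $n$). *)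

(* Defs.v *)
From HB Require Import structures.
From mathcomp Require Export all_boot all_order all_algebra.
From mathcomp Require Export all_classical all_reals all_analysis.
From mathcomp Require Export giry.

Set Implicit Arguments.
Unset Strict Implicit.
Unset Printing Implicit Defensive.

Import Order.TTheory GRing.Theory Num.Theory.
Import numFieldNormedType.Exports.

Local Open Scope classical_set_scope.
Local Open Scope ring_scope.

Record segment (R : realType) := Segment {
  seg_left : R;
  seg_right : R;
  seg_le : seg_left <= seg_right }.

Definition seg_set (R : realType) (I : segment R) : set R :=
  `[seg_left I, seg_right I]%classic.

Definition klee_volume (R : realType) (s : seq (segment R)) : \bar R :=
  lebesgue_measure (\big[setU/set0]_(I <- s) seg_set I).

(* Memory contents are bit strings of any length, so the number of bits in use
   may vary during a run and need not be bounded. *)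
Definition memory : Type := seq bool.

HB.instance Definition _ := Countable.on memory.
HB.instance Definition _ := isPointed.Build memory [::].
HB.instance Definition _ := @isMeasurable.Build default_measure_display
  memory discrete_measurable discrete_measurable0
  discrete_measurableC discrete_measurableU.

Lemma measurable_fun_memory d (T : measurableType d) (f : memory -> T) :
  measurable_fun [set: memory] f.
Proof. by []. Qed.

(* The random bits drawn for the initial state, for each update and for the
   output are independent of one another and are forgotten unless stored in the
   memory, so each of these is given by the law of its result.  The updates may
   depend arbitrarily on the real endpoints of the item that is read. *)
Record streaming_algorithm (R : realType) (item : Type) := StreamingAlgorithm {
  init : probability memory R;
  update : item -> memory -> probability memory R;
  output : memory -> probability R R }.

Section run.
Context (R : realType) (item : Type) (A : streaming_algorithm R item).

Definition update_giry (x : item) (m : memory) : giry memory R := update A x m.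

Definition output_giry (m : memory) : giry R R := output A m.

Definition memory_law (s : seq item) : giry memory R :=
  foldl (fun mu x => giry_bind mu (measurable_fun_memory (update_giry x)))
    (init A : giry memory R) s.

Definition output_law (s : seq item) : giry R R :=
  giry_bind (memory_law s) (measurable_fun_memory output_giry).

(* Prefixes of a stream are streams too, so the memory contents at the end of
   streams of at most [N] items include those occurring at any intermediate
   time. *)
Definition space (N : nat) : \bar R :=
  ereal_sup [set ((size m)%:R)%:E | m in
    [set m : memory | exists2 s : seq item,
       (size s <= N)%N & (0 < memory_law s [set m])%E]].

End run.

Definition klee_additive_solution (R : realType) (eps rho : R) (N : nat)
    (A : streaming_algorithm R (segment R)) : Prop :=
  forall s : seq (segment R), (size s <= N)%N ->
    ((1 - rho)%:E <=
       output_law A s [set v : R | (`|v%:E - klee_volume s| <= eps%:E)%E])%E.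

(* Main.v *)
Require Import Defs.
From mathcomp Require Import ring lra.
Import Order.TTheory GRing.Theory Num.Theory.
Local Open Scope ring_scope.

(** Reduction from the one-way communication problem INDEX.  A bit string x of
    length n is streamed as the intervals [j, j + x_j]; appending [0, i] and
    [i + 1, n] makes the volume n or n - 1 according to x_i, so for eps < 1/10
    the memory left after the first n items determines every x_i with
    probability 2/3.  Such a memory takes at least exp(n / 72) values.  Since
    the lengths do not depend on eps, n may be taken to be a large multiple of
    1/eps, and then n dominates both 1/eps and ln n. *)

Set Implicit Arguments.
Unset Strict Implicit.
Unset Printing Implicit Defensive.
Local Open Scope classical_set_scope.

(** * Lower bound on the number of messages for INDEX *)

(** Inverting [1 + v <= expR v] at [v = - (u / (1 + u))] gives [expR (u / (1 + u)) <= 1 + u]; this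
    exponent exceeds [u - 2 * u ^+ 2] by [u ^+ 2 * (1 + 2 * u) / (1 + u)]. *)
Lemma expR_le1D (R : realType) (u : R) :
  - 2^-1 <= u -> expR (u - 2 * u ^+ 2) <= 1 + u.
Proof.
move=> hu; have u1 : 0 < 1 + u by lra.
have h : u - 2 * u ^+ 2 <= u / (1 + u).
  by rewrite ler_pdivlMr// -subr_ge0; have := sqr_ge0 u; nra.
apply: (le_trans (y := expR (u / (1 + u)))); first by rewrite ler_expR.
rewrite -[leRHS]invrK -[u / (1 + u)]opprK expRN lef_pV2 ?posrE ?expR_gt0 ?invr_gt0//.
apply: le_trans (expR_ge1Dx _).
rewrite le_eqVlt; apply/orP; left; apply/eqP; field; lra.
Qed.

(* [y i m (x i)] is the advantage of the guess of [x i] from [m].  The product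
   [W x m] averages to 1 over x for each m, whereas its mean under [p x] is at
   least exp(n / 72), as the mean advantage is at least 1/3; the weights
   [p x m <= 1] then force many values of m. *)
Lemma index_message_bound (R : realType) (M : finType) (n : nat)
    (p : {ffun 'I_n -> bool} -> M -> R) (q : 'I_n -> M -> R) :
  (forall x m, 0 <= p x m) -> (forall x, \sum_m p x m = 1) ->
  (forall i m, 0 <= q i m <= 1) ->
  (forall (x : {ffun 'I_n -> bool}) i, if x i then 2 / 3 <= \sum_m p x m * q i m
    else \sum_m p x m * q i m <= 3^-1) ->
  expR (n%:R / 72) <= #|M|%:R :> R.
Proof.
move=> p0 p1 q01 hq.
pose y i m (b : bool) : R := if b then 2 * q i m - 1 else 1 - 2 * q i m.
(* The weight [t = 1/12] maximises [t / 3 - 2 * t ^+ 2], the gain from a mean advantage of [1/3]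
   less the loss in [expR_le1D]; the maximum is [1/72]. *)
pose W (x : {ffun 'I_n -> bool}) m := \prod_i (1 + 12^-1 * y i m (x i)).
have y1 i m b : -1 <= y i m b <= 1.
  by have := q01 i m; rewrite /y; case: b; lra.
have W0 x m : 0 <= W x m.
  by apply: prodr_ge0 => i _; have := y1 i m (x i); lra.
have sumW m : \sum_(x : {ffun 'I_n -> bool}) W x m = 2 ^+ n.
  rewrite /W -(bigA_distr_bigA (fun i b => 1 + 12^-1 * y i m b)).
  rewrite (eq_bigr (fun=> 2)); first by rewrite prodr_const card_ord.
  by move=> i _; rewrite big_bool /y /=; lra.
(* In place of Jensen's inequality, [expR] is bounded below by its tangent at [n / 72]. The bound is
   affine in the advantages, so it can be averaged over [m]. *)
have leW (x : {ffun 'I_n -> bool}) m : expR (n%:R / 72) *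
    (1 + (12^-1 * \sum_i y i m (x i) - n%:R / 36)) <= W x m.
  apply: (le_trans (y := expR (n%:R / 72) *
      expR (12^-1 * \sum_i y i m (x i) - n%:R / 36))).
    by rewrite ler_pM2l ?expR_gt0// expR_ge1Dx.
  rewrite -expRD (_ : _ + _ = \sum_i (12^-1 * y i m (x i) - 72^-1)); last first.
    rewrite sumrB -mulr_sumr sumr_const card_ord -(mulr_natl 72^-1).
    by lra.
  rewrite expR_sum; apply: ler_prod => i _; rewrite expR_ge0 /=.
  have := y1 i m (x i); set z := y i m (x i) => hz.
  apply: le_trans (expR_le1D _); last by lra.
  by rewrite ler_expR; nra.
have lepy (x : {ffun 'I_n -> bool}) i : 3^-1 <= \sum_m p x m * y i m (x i).
  have := hq x i; rewrite /y; case: (x i) => h.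
    rewrite (eq_bigr (fun m => 2 * (p x m * q i m) - p x m)); last by move=> m _; ring.
    by rewrite sumrB -mulr_sumr p1; lra.
  rewrite (eq_bigr (fun m => p x m - 2 * (p x m * q i m))); last by move=> m _; ring.
  by rewrite sumrB -mulr_sumr p1; lra.
have lepW (x : {ffun 'I_n -> bool}) : expR (n%:R / 72) <= \sum_m p x m * W x m.
  apply: (le_trans (y := \sum_m p x m * (expR (n%:R / 72) *
    (1 + (12^-1 * \sum_i y i m (x i) - n%:R / 36))))); last first.
    by apply: ler_sum => m _; exact: ler_wpM2l.
  rewrite (eq_bigr (fun m => expR (n%:R / 72) * (p x m * (1 - n%:R / 36) +
     12^-1 * \sum_i p x m * y i m (x i)))); last first.
    by move=> m _; rewrite -mulr_sumr; ring.
  rewrite -mulr_sumr ler_peMr ?expR_ge0// big_split/= -mulr_suml p1 -mulr_sumr.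
  rewrite exchange_big/=.
  suff : n%:R * 3^-1 <= \sum_i \sum_m p x m * y i m (x i) by lra.
  rewrite mulr_natl -[X in _ *+ X]card_ord -sumr_const.
  by apply: ler_sum => i _.
have p_le1 x m : p x m <= 1.
  by rewrite -(p1 x) (bigD1 m)//= lerDl sumr_ge0.
rewrite -(ler_pM2l (_ : 0 < 2 ^+ n)) ?exprn_gt0//.
apply: (le_trans (y := \sum_(x : {ffun 'I_n -> bool}) \sum_m p x m * W x m)).
  apply: (le_trans (y := \sum_(x : {ffun 'I_n -> bool}) expR (n%:R / 72))); last exact: ler_sum.
  by rewrite sumr_const card_ffun card_bool card_ord -[leRHS]mulr_natl natrX.
rewrite exchange_big/=.
apply: (le_trans (y := \sum_m \sum_(x : {ffun 'I_n -> bool}) W x m)).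
  by apply: ler_sum => m _; apply: ler_sum => x _; rewrite ler_piMl.
by rewrite (eq_bigr (fun=> 2 ^+ n)) // sumr_const mulr_natr.
Qed.

(** * The hard streams and their volumes *)

Lemma ler_natDr (R : realType) (a l : nat) : a%:R <= (a + l)%:R :> R.
Proof. by rewrite ler_nat leq_addr. Qed.

(** The second parameter is a length, so that every pair of naturals gives a valid segment. *)
Definition nat_segment (R : realType) (a l : nat) : segment R :=
  Segment (ler_natDr R a l).

Definition alice_stream (R : realType) n (x : {ffun 'I_n -> bool}) : seq (segment R) :=
  [seq nat_segment R (j : 'I_n) (x j) | j <- enum 'I_n].

Definition bob_stream (R : realType) n (i : 'I_n) : seq (segment R) :=
  [:: nat_segment R 0 i; nat_segment R i.+1 (n - i.+1)].

Lemma seg_set_nat (R : realType) a l :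
  seg_set (nat_segment R a l) = [set t | a%:R <= t <= a%:R + l%:R].
Proof. by apply/seteqP; split=> t; rewrite /seg_set /= in_itv /= natrD. Qed.

(** The items of Alice with [j != i] lie inside the two items of Bob. Only item [i] can fill the gap
    between these; for a zero bit it is the point [i], already covered. *)
Lemma alice_bob_unionE (R : realType) n (x : {ffun 'I_n -> bool}) (i : 'I_n) :
  \big[setU/set0]_(I <- alice_stream R x ++ bob_stream R i) seg_set I =
  if x i then `[0, n%:R] else `[0, i%:R] `|` `[i%:R + 1, n%:R].
Proof.
rewrite big_cat/= big_map -bigcup_seq !big_cons big_nil setU0 !seg_set_nat.
have ni : i.+1%:R + (n - i.+1)%:R = n%:R :> R by rewrite -natrD subnKC.
have hn j : (j < n)%N -> j%:R + 1 <= n%:R :> R by rewrite natr1 ler_nat.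
have i0 : 0 <= i%:R :> R by [].
have hi := hn _ (ltn_ord i).
rewrite ni add0r -natr1.
have x01 b : (b : bool)%:R = 0 :> R \/ b%:R = 1 :> R by case: b; [right|left].
apply/seteqP; split => t /=.
  case=> [[j _]|[|]].
  - rewrite seg_set_nat/=; have := hn _ (ltn_ord j); have j0 : 0 <= j%:R :> R by [].
    case: ifPn => xi; first by rewrite /= in_itv/=; case: (x01 (x j)) => ->; lra.
    rewrite /= !in_itv/=; case: (ltngtP i j) => [|ji|/ord_inj ij].
    + rewrite -(ler_nat R) -natr1; case: (x01 (x j)) => -> *; right; lra.
    + move: ji; rewrite -(ler_nat R) -natr1; case: (x01 (x j)) => -> *; left; lra.
    + by rewrite -ij (negbTE xi) mulr0n => *; left; lra.
  - by case: ifPn => xi; rewrite /= !in_itv/= => *; [|left]; lra.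
  - by case: ifPn => xi; rewrite /= !in_itv/= => *; [|right]; lra.
case: ifPn => xi; rewrite /= !in_itv/=; last by case=> *; right; [left|right]; lra.
case: (lerP t i%:R) => ti; first by move=> *; right; left; lra.
case: (lerP t (i%:R + 1)) => ti1; last by move=> *; right; right; lra.
by move=> _; left; exists i; [rewrite /= mem_enum | rewrite seg_set_nat/= xi mulr1n; lra].
Qed.

Lemma klee_volume_alice_bob (R : realType) n (x : {ffun 'I_n -> bool}) (i : 'I_n) :
  klee_volume (alice_stream R x ++ bob_stream R i) =
  (if x i then n%:R else n%:R - 1)%:E.
Proof.
have hi : i%:R + 1 <= n%:R :> R by rewrite natr1 ler_nat.
have i0 : 0 <= i%:R :> R by [].
have itvE a b : a <= b -> lebesgue_measure (`[a, b] : set R) = (b - a)%:E.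
  by rewrite lebesgue_measure_itv/= lte_fin; case: ltgtP => // -> _; rewrite subrr.
rewrite /klee_volume alice_bob_unionE; case: ifPn => xi.
  by rewrite itvE ?subr0.
rewrite measureU//.
  by rewrite [X in (X + _)%E]itvE// [X in (_ + X)%E]itvE// -EFinD; congr EFin; lra.
by apply/seteqP; split => t //=; rewrite !in_itv/=; lra.
Qed.

(** * Splitting a run into a message and its decoding *)

Section future_integral.
Context (R : realType) (item : Type) (A : streaming_algorithm R item).

(* Expectation of [h] at the memory reached from a given one by reading [s]. *)
Definition future_integral (h : memory -> \bar R) (s : seq item) :=
  foldr (fun x g m => giry_int (update_giry A x m) g) h s.

Lemma future_integral_ge0 h s : (forall m, 0 <= h m)%E ->
  forall m, (0 <= future_integral h s m)%E.
Proof. by move=> h0; elim: s => //= x s IH m; exact: integral_ge0. Qed.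

(** Pushing laws forward is dual to pulling [h] back. The starting law is arbitrary because the
    induction changes it at each item. *)
Lemma giry_int_run (mu : giry memory R) h s : (forall m, 0 <= h m)%E ->
  giry_int (foldl (fun mu x => giry_bind mu (measurable_fun_memory (update_giry A x))) mu s) h =
  giry_int mu (future_integral h s).
Proof.
move=> h0; elim: s mu => //= x s IH mu.
by rewrite IH giry_int_bind//; exact: future_integral_ge0.
Qed.

Lemma giry_int_le1 (mu : giry memory R) (h : memory -> \bar R) :
  (forall m, 0 <= h m <= 1)%E -> (0 <= giry_int mu h <= 1)%E.
Proof.
move=> h01; apply/andP; split; first by apply: integral_ge0 => m _; case/andP: (h01 m).
apply: (@le_trans _ _ (giry_int mu (cst 1%E))).
  by apply: ge0_le_integral => // m _; case/andP: (h01 m).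
by rewrite /giry_int integral_cst// mul1e; exact: sprobability_setT.
Qed.

Lemma future_integral_le1 h s : (forall m, 0 <= h m <= 1)%E ->
  forall m, (0 <= future_integral h s m <= 1)%E.
Proof. by move=> h0; elim: s => //= x s IH m; exact: giry_int_le1. Qed.

(** Separates the message, whose law depends on [s] only, from the decoder, which depends on [t]
    only. *)
Lemma output_law_cat s t (B : set R) : measurable B ->
  output_law A (s ++ t) B =
  giry_int (memory_law A s) (future_integral (fun m => output A m B) t).
Proof.
move=> mB.
transitivity (giry_int (memory_law A (s ++ t)) (fun m => output A m B)).
  by rewrite /output_law /giry_bind /= giry_int_map//; exact: measurable_giry_ev.
by rewrite /memory_law foldl_cat giry_int_run.
Qed.

(** A [giry] measure only has mass at most 1; equality comes from [init] and [update] being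
    probabilities. *)
Lemma memory_law_setT s : memory_law A s setT = 1%E.
Proof.
have runT (mu : giry memory R) : mu setT = giry_int mu (cst 1%E).
  by rewrite /giry_int integral_cst// mul1e.
rewrite runT giry_int_run//.
have fut1 : future_integral (cst 1%E) s = cst 1%E.
  elim: s => //= x s ->; apply/funext => m.
  by rewrite -runT; exact: probability_setT.
by rewrite fut1 -runT; exact: probability_setT.
Qed.

End future_integral.

(** The long strings together form a null set, so [f] agrees almost everywhere with a finite
    combination of indicators of short strings. *)
Lemma giry_int_bounded_support (R : realType) (K : nat) (mu : giry memory R)
    (f : memory -> \bar R) :
  (forall m, 0 <= f m)%E ->
  (forall m, (K < size m)%N -> mu [set m] = 0%E) ->
  giry_int mu f = (\sum_(w : K.-bseq bool) f w * mu [set (w : memory)])%E.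
Proof.
move=> f0 mu0.
have null : mu [set m | (K < size m)%N] = 0%E.
  apply/(@negligibleP _ _ _ mu) => //.
  (* Enumeration by [unpickle] covers the long strings by countably many sets, each empty or a null
     singleton. *)
  suff : mu.-negligible (\bigcup_k [set m : memory | unpickle k = Some m /\ (K < size m)%N]).
    by apply: negligibleS => m /= Km; exists (pickle m) => //=; rewrite pickleK.
  apply: negligible_bigcup => k; apply/(@negligibleP _ _ _ mu) => //.
  case: (pselect (exists m : memory, unpickle k = Some m /\ (K < size m)%N)) => [[m [km Km]]|no].
    have -> : [set m | unpickle k = Some m /\ (K < size m)%N] = [set m].
      by apply/seteqP; split => m' /=; [rewrite km => -[[->]] | move=> ->].
    exact: mu0.
  have -> : [set m : memory | unpickle k = Some m /\ (K < size m)%N] = set0.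
    by apply/seteqP; split => m' //= [km Km]; apply: no; exists m'.
  exact: measure0.
transitivity (\int[mu]_x (\sum_(w : K.-bseq bool) f w * (\1_[set (w : memory)] x)%:E))%E.
  apply: ge0_ae_eq_integral => //.
  - by move=> m _; apply: sume_ge0 => w _; rewrite mule_ge0// lee_fin.
  - exists [set m | (K < size m)%N]; split => // m /=.
    apply: contra_notP => /negP; rewrite -leqNgt => mK _.
    rewrite (bigD1 (Bseq mK))//= indicE mem_set// mule1 big1 ?adde0// => w wm.
    rewrite indicE memNset ?mule0// => /= mw; move: wm.
    by rewrite -val_eqE /= mw eqxx.
rewrite ge0_integral_sum//; last by move=> w m _; rewrite mule_ge0// lee_fin.
apply: eq_bigr => w _.
rewrite ge0_integralZl//.
by rewrite integral_indic// setIT.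
Qed.

(** * From a streaming algorithm to an INDEX protocol *)

(** The threshold is midway between the volumes [n - 1] and [n]. The event of a correct answer lies
    above it when the bit is 1 and is disjoint from that side when the bit is 0. *)
Lemma additive_solution_decides (R : realType) (eps : R) (N n : nat)
    (A : streaming_algorithm R (segment R)) (x : {ffun 'I_n -> bool}) (i : 'I_n) :
  eps < 10^-1 -> (n.+2 <= N)%N -> klee_additive_solution eps 3^-1 N A ->
  let P := output_law A (alice_stream R x ++ bob_stream R i)
             `]n%:R - 2^-1, +oo[ in
  if x i then ((2 / 3)%:E <= P)%E else (P <= (3^-1)%:E)%E.
Proof.
move=> eps1 nN /(_ (alice_stream R x ++ bob_stream R i)).
rewrite size_cat size_map size_enum_ord addn2 => /(_ nN).
rewrite klee_volume_alice_bob; move: (output_law A _) => mu /=.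
have Eitv (r : R) : [set v | (`|v%:E - r%:E| <= eps%:E)%E] = `[r - eps, r + eps].
  by apply/seteqP; split => v /=; rewrite in_itv/= lee_fin ler_distl.
have -> : 1 - 3^-1 = 2 / 3 :> R by lra.
rewrite Eitv; set T : set R := `]_, +oo[; set E : set R := `[_, _] => hE.
have mT : measurable T by exact: measurable_itv.
have mE : measurable E by exact: measurable_itv.
move: @T @E mT mE hE; case: (x i) => T E mT mE hE.
  apply: (le_trans hE); apply: (@le_measure _ _ _ mu); rewrite ?inE//.
  by move=> v; rewrite /T /E /= !in_itv/=; lra.
have TE0 : T `&` E = set0.
  by apply/seteqP; split => v //; rewrite /T /E /= !in_itv/=; lra.
have TE1 : (mu T + mu E <= 1)%E.
  have <- : mu (T `|` E) = (mu T + mu E)%E by exact: measureU.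
  apply: le_trans (@sprobability_setT _ _ _ mu).
  by apply: (@le_measure _ _ _ mu); rewrite ?inE//; exact: measurableU.
have fT : mu T \is a fin_num by exact: fin_num_measure.
have fE : mu E \is a fin_num by exact: fin_num_measure.
by move: hE TE1; rewrite -(fineK fT) -(fineK fE) -EFinD !lee_fin; lra.
Qed.

(** The message is the memory after Alice's items, and [Q i] is the chance that Bob's run from it
    ends above the threshold. Bounded support makes the set of messages finite. *)
Lemma memory_bound (R : realType) (eps : R) (N n K : nat)
    (A : streaming_algorithm R (segment R)) :
  eps < 10^-1 -> (n.+2 <= N)%N -> klee_additive_solution eps 3^-1 N A ->
  (forall (s : seq (segment R)) m, (size s <= N)%N -> (K < size m)%N ->
     memory_law A s [set m] = 0%E) ->
  expR (n%:R / 72) <= (2 ^ K.+1)%:R :> R.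
Proof.
move=> eps1 nN hA suppA.
pose law (x : {ffun 'I_n -> bool}) := memory_law A (alice_stream R x).
pose T : set R := `]n%:R - 2^-1, +oo[.
pose Q (i : 'I_n) := future_integral A (fun m => output A m T) (bob_stream R i).
have Q01 i m : (0 <= Q i m <= 1)%E.
  apply: future_integral_le1 => m0; rewrite measure_ge0 probability_le1//.
  exact: measurable_itv.
have law_fin x m : law x [set m] \is a fin_num by exact: fin_num_measure.
have Q_fin i m : Q i m \is a fin_num.
  have /andP[Q0 Q1] := Q01 i m.
  by rewrite ge0_fin_numE// (le_lt_trans Q1)// ltry.
have law0 x m : (K < size m)%N -> law x [set m] = 0%E.
  move=> Km; apply: suppA => //; rewrite size_map size_enum_ord.
  by rewrite (leq_trans _ nN)// ltnW.
(* There are [2 ^ K.+1 - 1] strings of at most [K] bits. *)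
apply: (@le_trans _ _ #|{: K.-bseq bool}|%:R); last first.
  rewrite ler_nat card_bseq card_bool; apply: ltnW.
  by elim: K.+1 => [|k IH]; rewrite ?big_ord0// big_ord_recr/= expnS mul2n -addnn ltn_add2r.
apply: (@index_message_bound R (K.-bseq bool) n
    (fun x (w : K.-bseq bool) => fine (law x [set (w : memory)]))
    (fun i (w : K.-bseq bool) => fine (Q i w))) => [x w|x|i w|x i].
- exact: fine_ge0.
- have := memory_law_setT A (alice_stream R x); rewrite -/(law x).
  have -> : law x setT = giry_int (law x) (cst 1%E).
    by rewrite /giry_int integral_cst// mul1e.
  rewrite (giry_int_bounded_support _ (@law0 x))// => e.
  apply: EFin_inj; rewrite -[RHS]e -sumEFin; apply: eq_bigr => w _.
  by rewrite mul1e fineK.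
- by have := Q01 i w; rewrite -[Q i w]fineK// !lee_fin.
- have : (\sum_(w : K.-bseq bool) fine (law x [set (w : memory)]) * fine (Q i w))%:E =
      output_law A (alice_stream R x ++ bob_stream R i) T.
    rewrite output_law_cat; last exact: measurable_itv.
    have Q0 m : (0 <= Q i m)%E by have /andP[] := Q01 i m.
    rewrite (giry_int_bounded_support Q0 (@law0 x)).
    rewrite -sumEFin; apply: eq_bigr => w _.
    by rewrite muleC EFinM !fineK.
  have := additive_solution_decides x i eps1 nN hA; rewrite /= -/T.
  by case: (x i) => h e; rewrite -lee_fin e.
Qed.

Lemma le_size_space (R : realType) item (A : streaming_algorithm R item) (N : nat)
    (s : seq item) (m : memory) :
  (size s <= N)%N -> (0 < memory_law A s [set m])%E ->
  ((size m)%:R%:E <= space A N)%E.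
Proof. by move=> sN Am; apply: ereal_sup_ubound; exists m => //; exists s. Qed.

Theorem theorem4 (R : realType) :
  exists2 c : R, 0 < c &
    forall eps : R, 0 < eps < 10^-1 ->
      exists2 n : nat, (0 < n)%N &
        forall A : streaming_algorithm R (segment R),
          klee_additive_solution eps 3^-1 (2 * n) A ->
          ((c * (eps^-1 + ln n%:R))%:E <= space A (2 * n))%E.
Proof.
(* For [n = 144 * K.+1], [ln n <= n - 1] gives [eps^-1 + ln n < 145 * K.+1], so space below the
   claimed bound is less than [K.+1]. *)
exists (145^-1); first by rewrite invr_gt0.
move=> eps /andP[eps0 eps1].
pose K := Num.truncn eps^-1.
have epsK : eps^-1 < K.+1%:R by exact: truncnS_gt.
(* As [144 = 2 * 72], [expR (n / 72)] is [expR 2 ^+ K.+1], which exceeds [2 ^+ K.+1] because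
   [expR 2 >= 3]. *)
exists (144 * K.+1)%N => // A hA.
rewrite leNgt; apply/negP => spA.
have lnn : ln (144 * K.+1)%:R <= 144 * K.+1%:R - 1 :> R.
  have n0 : 0 < 144 * K.+1%:R :> R by rewrite mulr_gt0.
  by have := expR_ge1Dx (ln (144 * K.+1%:R) : R); rewrite natrM lnK ?posrE//; lra.
have space_lt : (space A (2 * (144 * K.+1)) < K.+1%:R%:E)%E.
  by apply: lt_trans spA _; rewrite lte_fin; lra.
have : expR ((144 * K.+1)%:R / 72) <= (2 ^ K.+1)%:R :> R.
  apply: (memory_bound eps1 _ hA) => [|s m sN Km].
    by rewrite mul2n -addnn -addn2 leq_add2l mulnS.
  (* A string of more than [K] bits with positive probability would force the space up to [K.+1]. *)
  apply/eqP; rewrite eq_le measure_ge0 andbT leNgt; apply/negP => Am.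
  have := le_lt_trans (le_size_space sN Am) space_lt.
  by rewrite lte_fin ltr_nat ltnNge Km.
rewrite leNgt => /negP; apply.
have -> : (144 * K.+1)%:R / 72 = K.+1%:R * 2 :> R by rewrite natrM; lra.
rewrite mulrC expRM_natr natrX ltrXn2r// ?expR_ge0//.
by apply: lt_le_trans (expR_ge1Dx _); lra.
Qed.
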